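(* Let $\epsilon,\mu>0$ be constants, let $\mathbf{w}\in\mathbb{R}^3\setminus\{0\}$, $\mathbf{a}_{\mathbf{w}}\in\mathbb{C}^3$, and $\alpha_{\mathbf{w}}=(\alpha_{1,\mathbf{w}},\alpha_{2,\mathbf{w}},\alpha_{3,\mathbf{w}})^T=V_{\mathbf{w}}^\dagger\mathbf{a}_{\mathbf{w}}$. Let $$F_{\alpha_{\mathbf{w}},\mathbf{w}}(\mathbf{x},t)=\sum_{1\le d\le3}e^{\frac{-it\mu_{d,\mathbf{w}}}{\sqrt{\mu\epsilon}}}\,\alpha_{d,\mathbf{w}}\mathbf{v}_{d,\mathbf{w}}e^{i\mathbf{x}\cdot\mathbf{w}},$$ $$E_{\alpha_{\mathbf{w}},\mathbf{w}}(\mathbf{x},t)=\frac12\left(F_{\alpha_{\mathbf{w}},\mathbf{w}}+\overline{F_{\alpha_{\mathbf{w}},\mathbf{w}}}\right)(\mathbf{x},t),\qquad H_{\alpha_{\mathbf{w}},\mathbf{w}}(\mathbf{x},t)=\frac i2\left(\overline{F_{\alpha_{\mathbf{w}},\mathbf{w}}}-F_{\alpha_{\mathbf{w}},\mathbf{w}}\right)(\mathbf{x},t).$$ Then: (1) $|E_{\alpha_{\mathbf{w}},\mathbf{w}}(\mathbf{x},t)|^2+|H_{\alpha_{\mathbf{w}},\mathbf{w}}(\mathbf{x},t)|^2$ is constant (in $\mathbf{x}$ and $t$); (2) $|E_{\alpha_{\mathbf{w}},\mathbf{w}}(\mathbf{x},t)|$, $|H_{\alpha_{\mathbf{w}},\mathbf{w}}(\mathbf{x},t)|$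 and $E_{\alpha_{\mathbf{w}},\mathbf{w}}(\mathbf{x},t)\cdot H_{\alpha_{\mathbf{w}},\mathbf{w}}(\mathbf{x},t)$ are stationary, i.e. they do not depend on $t$.
   Context: For $\mathbf{w}=(w_1,w_2,w_3)^T\in\mathbb{R}^3\setminus\{0\}$ put $s_{\mathbf{w}}=w_1+w_2+w_3$, $\mathbf{r}_{\mathbf{w}}=(w_2-w_3,w_3-w_1,w_1-w_2)^T$, $\nu_{\mathbf{w}}=\sqrt2\,|\mathbf{r}_{\mathbf{w}}|/|\mathbf{w}|$, and $\mu_{1,\mathbf{w}}=0$, $\mu_{2,\mathbf{w}}=-|\mathbf{w}|$, $\mu_{3,\mathbf{w}}=|\mathbf{w}|$ (not to be confused with the constant $\mu$). Put $\mathbf{v}_{1,\mathbf{w}}=\mathbf{w}/|\mathbf{w}|$. If $\mathbf{r}_{\mathbf{w}}\neq0$, put for $d=2,3$ $$\mathbf{v}_{d,\mathbf{w}}=\frac{1}{\nu_{\mathbf{w}}}\left(\frac{s_{\mathbf{w}}}{|\mathbf{w}|^2}\mathbf{w}-(1,1,1)^T-i\frac{\mu_{d,\mathbf{w}}}{|\mathbf{w}|^2}\mathbf{r}_{\mathbf{w}}\right).$$ If $\mathbf{r}_{\mathbf{w}}=0$, i.e. $w_1=w_2=w_3=\omega$, let $v_2=\frac{1}{\sqrt3}\left(\frac{1+i\sqrt3}{2},\frac{1-i\sqrt3}{2},-1\right)^T$ and put $\mathbf{v}_{2,\mathbf{w}}=v_2$ if $\omega\ge0$, $\mathbf{v}_{2,\mathbf{w}}=\overline{v_2}$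 if $\omega<0$, and $\mathbf{v}_{3,\mathbf{w}}=\overline{\mathbf{v}_{2,\mathbf{w}}}$. $V_{\mathbf{w}}$ is the matrix with columns $\mathbf{v}_{1,\mathbf{w}},\mathbf{v}_{2,\mathbf{w}},\mathbf{v}_{3,\mathbf{w}}$ and $V_{\mathbf{w}}^\dagger$ its conjugate transpose. The vectors $E_{\alpha_{\mathbf{w}},\mathbf{w}},H_{\alpha_{\mathbf{w}},\mathbf{w}}$ are $\mathbb{R}^3$-valued (real and imaginary parts of $F_{\alpha_{\mathbf{w}},\mathbf{w}}$), with the Euclidean norm and dot product. *)

(* Defs.v *)
From mathcomp Require Import all_boot all_order all_algebra.
From mathcomp Require Import complex.
From mathcomp Require Import reals sequences exp trigo.

Set Implicit Arguments.
Unset Strict Implicit.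
Unset Printing Implicit Defensive.

Import Order.TTheory GRing.Theory Num.Theory.

Local Open Scope ring_scope.
Local Open Scope complex_scope.

Section Vectors.
Variable R : realType.

(* The matrix norm [`|u|] of MathComp-Analysis is the sup norm, so the Euclidean
   norm on R^3 is defined here. *)
Definition dotp (u v : 'cV[R]_3) : R := \sum_(i < 3) u i 0 * v i 0.
Definition enorm (u : 'cV[R]_3) : R := Num.sqrt (dotp u u).

Definition vec3 (T : Type) (a b c : T) : 'cV[T]_3 :=
  \col_(i < 3) nth a [:: a; b; c] i.

Definition to_complex (u : 'cV[R]_3) : 'cV[R[i]]_3 := map_mx (real_complex R) u.
Definition conjv (u : 'cV[R[i]]_3) : 'cV[R[i]]_3 := map_mx Num.conj u.

Definition cexp (z : R[i]) : R[i] :=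
  (expR (complex.Re z))%:C * (cos (complex.Im z) +i* sin (complex.Im z)).

End Vectors.

(* Indices are 0-based: mu_{d,w} and v_{d,w} for d = 1, 2, 3 are [muw] and [vw]
   at 0, 1, 2 : 'I_3, and likewise for the coordinates of vectors. *)
Section Eigenvectors.
Variables (R : realType) (w : 'cV[R]_3).

Definition sw : R := w 0 0 + w 1 0 + w 2 0.

Definition rw : 'cV[R]_3 :=
  vec3 (w 1 0 - w 2 0) (w 2 0 - w 0 0) (w 0 0 - w 1 0).

Definition nuw : R := Num.sqrt 2 * enorm rw / enorm w.

Definition muw (d : 'I_3) : R := nth 0 [:: 0; - enorm w; enorm w] d.

Definition v2 : 'cV[R[i]]_3 :=
  (Num.sqrt 3)^-1%:C *:
    vec3 ((1 + 'i * (Num.sqrt 3)%:C) / 2) ((1 - 'i * (Num.sqrt 3)%:C) / 2) (-1).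

(* v_{2,w} when r_w = 0; then all three coordinates of w equal w 0 0. *)
Definition v2w0 : 'cV[R[i]]_3 := if 0 <= w 0 0 then v2 else conjv v2.

Definition vw (d : 'I_3) : 'cV[R[i]]_3 :=
  if d == 0 then to_complex ((enorm w)^-1 *: w)
  else if rw != 0 then
    (nuw^-1)%:C *:
      ((sw / enorm w ^+ 2)%:C *: to_complex w - vec3 1 1 1
       - ('i * (muw d / enorm w ^+ 2)%:C) *: to_complex rw)
  else if d == 1 then v2w0 else conjv v2w0.

Definition Vw : 'M[R[i]]_3 := \matrix_(i < 3, d < 3) vw d i 0.

End Eigenvectors.

Section Fields.
Variables (R : realType) (eps mu : R) (alpha : 'cV[R[i]]_3) (w : 'cV[R]_3).

Definition Ffield (x : 'cV[R]_3) (t : R) : 'cV[R[i]]_3 :=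
  \sum_(d < 3)
    (cexp (- 'i * t%:C * (muw w d)%:C / (Num.sqrt (mu * eps))%:C)
     * alpha d 0 * cexp ('i * (dotp x w)%:C)) *: vw w d.

Definition EfieldC (x : 'cV[R]_3) (t : R) : 'cV[R[i]]_3 :=
  2^-1 *: (Ffield x t + conjv (Ffield x t)).

Definition HfieldC (x : 'cV[R]_3) (t : R) : 'cV[R[i]]_3 :=
  ('i / 2) *: (conjv (Ffield x t) - Ffield x t).

(* [EfieldC] and [HfieldC] have real entries (lemmas [EfieldE], [HfieldE]);
   [Efield] and [Hfield] are the same vectors, viewed in R^3. *)
Definition Efield (x : 'cV[R]_3) (t : R) : 'cV[R]_3 :=
  map_mx (@complex.Re R) (EfieldC x t).

Definition Hfield (x : 'cV[R]_3) (t : R) : 'cV[R]_3 :=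
  map_mx (@complex.Re R) (HfieldC x t).

Lemma EfieldE x t : to_complex (Efield x t) = EfieldC x t.
Proof.
rewrite /Efield /EfieldC; move: (Ffield x t) => F.
apply/matrixP => i j; rewrite !mxE.
apply/eqP; rewrite eq_complex /= eqxx /=; apply/eqP.
have -> : (2%:R : R[i])^-1 = (2%:R^-1 : R)%:C by rewrite fmorphV rmorph_nat.
by case: (F i j) => a b /=; rewrite mul0r addr0 addrN mulr0.
Qed.

Lemma HfieldE x t : to_complex (Hfield x t) = HfieldC x t.
Proof.
rewrite /Hfield /HfieldC; move: (Ffield x t) => F.
apply/matrixP => i j; rewrite !mxE.
apply/eqP; rewrite eq_complex /= eqxx /=; apply/eqP.
have -> : (2%:R : R[i])^-1 = (2%:R^-1 : R)%:C by rewrite fmorphV rmorph_nat.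
by case: (F i j) => a b /=; rewrite subrr !mul0r !mulr0 subr0 mul0r addr0.
Qed.

End Fields.

(* Main.v *)
Require Import Defs.
From mathcomp Require Import all_boot all_order all_algebra.
From mathcomp Require Import complex.
From mathcomp Require Import spectral reals.
From mathcomp Require Import exp trigo ring lra.
Import Order.TTheory GRing.Theory Num.Theory.
Local Open Scope ring_scope.
Local Open Scope complex_scope.
Local Open Scope sesquilinear_scope.

(** The vectors v_1, v_2, v_3 satisfy v_1 real, v_3 = conj v_2 and, for the
    bilinear (not Hermitian) product, v_1.v_1 = v_2.v_3 = 1 with all other
    products zero: v_2 and v_3 are p + iq and p - iq with p, q, w mutually
    orthogonal and |p|^2 = |q|^2 = 1/2. Since mu_2 = - mu_3, the time phases
    cancel in F.F = e^{2i x.w} (alpha_1^2 + 2 alpha_2 alpha_3) and in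
    F.conj(F) = sum |alpha_d|^2. The conclusion follows from
    F.F = |E|^2 - |H|^2 + 2i E.H and F.conj(F) = |E|^2 + |H|^2. *)

(** * Bilinear product in dimension 3 *)

Lemma sum3E {V : nmodType} (f : 'I_3 -> V) :
  \sum_(i < 3) f i = f 0 + f 1 + f 2.
Proof.
rewrite !big_ord_recl big_ord0 addr0 addrA.
by congr (_ + f _ + f _); apply/val_inj.
Qed.

(** Stated over any commutative ring, so that over the reals it unfolds to [dotp]. *)
Definition bdot {K : comNzRingType} (u v : 'cV[K]_3) : K :=
  \sum_(i < 3) u i 0 * v i 0.

Lemma bdotE {K : comNzRingType} (u v : 'cV[K]_3) :
  bdot u v = u 0 0 * v 0 0 + u 1 0 * v 1 0 + u 2 0 * v 2 0.
Proof. exact: sum3E. Qed.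

Lemma dotpE {R : realType} (u v : 'cV[R]_3) :
  dotp u v = u 0 0 * v 0 0 + u 1 0 * v 1 0 + u 2 0 * v 2 0.
Proof. exact: bdotE. Qed.

Section ComplexDot.
Variable R : realType.
Implicit Types u v : 'cV[R[i]]_3.

Let Rev u : 'cV[R]_3 := map_mx (@complex.Re R) u.
Let Imv u : 'cV[R]_3 := map_mx (@complex.Im R) u.

Lemma bdot_self u :
  bdot u u = (dotp (Rev u) (Rev u) - dotp (Imv u) (Imv u))
             +i* (2 * dotp (Rev u) (Imv u)).
Proof.
rewrite !bdotE !dotpE !mxE.
case: (u 0 0) (u 1 0) (u 2 0) => [a b] [c d] [e f]; simpc.
by congr (_ +i* _) => /=; ring.
Qed.

Lemma bdot_conj u :
  bdot u (conjv u) = (dotp (Rev u) (Rev u) + dotp (Imv u) (Imv u))%:C.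
Proof.
rewrite !bdotE !dotpE !mxE.
case: (u 0 0) (u 1 0) (u 2 0) => [a b] [c d] [e f]; simpc.
by congr (_ +i* _) => /=; ring.
Qed.

End ComplexDot.

(** A unit vector orthogonal to a hyperbolic pair. *)
Definition isotropic_frame {K : comNzRingType} (e u v : 'cV[K]_3) : Prop :=
  [/\ bdot e e = 1, bdot e u = 0 & bdot e v = 0] /\
  [/\ bdot u u = 0, bdot u v = 1 & bdot v v = 0].

(** As z^2 = -1 and p.q = 0, the square of p + zq or p - zq is p.p - q.q = 0, and their product is
    p.p + q.q = 1. *)
Lemma bdot_isotropic {K : numFieldType} (e p q : 'cV[K]_3) (z : K) :
  z * z = -1 -> bdot e e = 1 -> bdot e p = 0 -> bdot e q = 0 ->
  bdot p q = 0 -> bdot p p = 2^-1 -> bdot q q = 2^-1 ->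
  isotropic_frame e (p + z *: q) (p - z *: q).
Proof.
move=> zz ee ep eq pq pp qq.
have er y : bdot e (p + y *: q) = bdot e p + y * bdot e q.
  by rewrite !bdotE !mxE; ring.
have rr y y' : bdot (p + y *: q) (p + y' *: q)
    = bdot p p + (y + y') * bdot p q + y * y' * bdot q q.
  by rewrite !bdotE !mxE; ring.
rewrite /isotropic_frame -scaleNr !er !rr ee ep eq pq pp qq !(mulrN, mulNr) zz.
rewrite !mulr0 !addr0 !mulN1r !opprK !subrr.
by split; split => //; field.
Qed.

(** Only e.e and u.v survive the expansion. The scalars [z], [z'] are meant for the spatial factor
    of the field. *)
Lemma bdot_frame {K : comNzRingType} {e u v : 'cV[K]_3} (z a b c z' a' b' c' : K) :
  isotropic_frame e u v ->
  bdot (z *: (a *: e + b *: u + c *: v)) (z' *: (a' *: e + b' *: u + c' *: v))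
  = z * z' * (a * a' + b * c' + c * b').
Proof.
move=> [[ee eu ev] [uu uv vv]].
transitivity (z * z' * (a * a' * bdot e e + (a * b' + b * a') * bdot e u
  + (a * c' + c * a') * bdot e v + b * b' * bdot u u
  + (b * c' + c * b') * bdot u v + c * c' * bdot v v)).
  by rewrite !bdotE !mxE; ring.
by rewrite ee eu ev uu uv vv; ring.
Qed.

(** * Exponentials of imaginary numbers *)

Section CExp.
Variable R : realType.

Lemma cexp_imag (y : R) : cexp ('i * y%:C) = cos y +i* sin y.
Proof. by simpc; rewrite /cexp /= expR0 mul1r. Qed.

Lemma cexp_imag0 : cexp ('i * 0%:C) = 1 :> R[i].
Proof. by rewrite cexp_imag cos0 sin0. Qed.

Lemma cexp_conj (y : R) : Num.conj (cexp ('i * y%:C)) = cexp ('i * (- y)%:C).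
Proof. by rewrite !cexp_imag cosN sinN. Qed.

Lemma cexp_mulN (y : R) : cexp ('i * y%:C) * cexp ('i * (- y)%:C) = 1.
Proof.
rewrite !cexp_imag cosN sinN; simpc; apply/eqP; rewrite eq_complex /=.
by rewrite -!expr2 cos2Dsin2 eqxx mulrC addrC subrr eqxx.
Qed.

End CExp.

(** * Coordinates, real vectors in complex space, Euclidean norm *)

Lemma conj_complexE {R : realType} (a b : R) : Num.conj (a +i* b) = a -i* b.
Proof. by []. Qed.

Lemma cV3_eq {T : Type} (u v : 'cV[T]_3) :
  u 0 0 = v 0 0 -> u 1 0 = v 1 0 -> u 2 0 = v 2 0 -> u = v.
Proof.
move=> e0 e1 e2; apply/matrixP => i j; rewrite ord1.
case: (unliftP 0 i) => [{}i ->|-> //]; case: (unliftP 0 i) => [{}i ->|->].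
  by rewrite (_ : lift _ _ = 2) //; apply/val_inj; rewrite ord1.
by rewrite (_ : lift _ _ = 1) //; apply/val_inj.
Qed.

Lemma to_complexZ {R : realType} a (u : 'cV[R]_3) :
  to_complex (a *: u) = a%:C *: to_complex u.
Proof. exact: map_mxZ. Qed.

Lemma to_complexN {R : realType} (u : 'cV[R]_3) :
  to_complex (- u) = - to_complex u.
Proof. exact: map_mxN. Qed.

Lemma to_complexB {R : realType} (u v : 'cV[R]_3) :
  to_complex (u - v) = to_complex u - to_complex v.
Proof. exact: map_mxB. Qed.

Lemma dotp_self_gt0 {R : realType} (u : 'cV[R]_3) : u != 0 -> 0 < dotp u u.
Proof.
move=> u0; rewrite lt_def sumr_ge0 ?andbT => [|i _]; last exact: sqr_ge0.
apply: contra u0 => /eqP uu0; apply/eqP/matrixP => i j; rewrite ord1 mxE.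
apply/eqP; rewrite -sqrf_eq0; apply/eqP.
by apply: (psumr_eq0P _ uu0) => // k _; exact: sqr_ge0.
Qed.

Lemma enorm_sqr {R : realType} (u : 'cV[R]_3) : enorm u ^+ 2 = dotp u u.
Proof. by rewrite sqr_sqrtr // sumr_ge0 // => i _; exact: sqr_ge0. Qed.

Lemma enorm_neq0 {R : realType} (u : 'cV[R]_3) : u != 0 -> enorm u != 0.
Proof. by move=> u0; rewrite sqrtr_eq0 -ltNge dotp_self_gt0. Qed.

(** * Geometry of the eigenvectors *)

Section Eigenframe.
Variables (R : realType) (w : 'cV[R]_3).
Hypothesis w_neq0 : w != 0.

(** Lagrange's identity, since r_w is the cross product of w and (1,1,1), and s_w their dot
    product. *)
Lemma dotp_rw : dotp (rw w) (rw w) = 3 * enorm w ^+ 2 - sw w ^+ 2.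
Proof. by rewrite enorm_sqr !dotpE !mxE /= /sw; ring. Qed.

Lemma rw_eq0 : rw w = 0 -> (w 1 0 = w 0 0) * (w 2 0 = w 0 0).
Proof.
move=> /matrixP r0; have := r0 1 0; have := r0 2 0.
by rewrite !mxE /= => /subr0_eq -> /subr0_eq ->.
Qed.

(** If r_w is nonzero, p is a multiple of the component of (1,1,1) orthogonal to w, and q a multiple
    of r_w, which is orthogonal to both w and (1,1,1). If r_w = 0, both are read off [v2]. *)
Lemma vw_split : exists p q : 'cV[R]_3,
  [/\ [/\ dotp w p = 0, dotp w q = 0 & dotp p q = 0],
      dotp p p = 2^-1, dotp q q = 2^-1,
      vw w 1 = to_complex p + 'i *: to_complex q &
      vw w 2 = to_complex p - 'i *: to_complex q].
Proof.
have n0 := enorm_neq0 w w_neq0; have nn := enorm_sqr w; rewrite dotpE in nn.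
have [r0|r0] := eqVneq (rw w) 0.
  have [w1 w2] := rw_eq0 r0.
  have s3 : Num.sqrt 3 ^+ 2 = 3 :> R by rewrite sqr_sqrtr.
  have s30 : Num.sqrt 3 != 0 :> R by rewrite sqrtr_eq0 -ltNge.
  (* Real and imaginary parts of [v2]; the sign [sg] records whether [v2w0] is [v2] or its
     conjugate. *)
  pose p : 'cV[R]_3 := (Num.sqrt 3)^-1 *: vec3 (2^-1) (2^-1) (-1).
  pose q : 'cV[R]_3 := vec3 (2^-1) (- 2^-1) 0.
  pose sg : R := if 0 <= w 0 0 then 1 else -1.
  have sg2 : sg * sg = 1 by rewrite /sg; case: ifP => _; ring.
  exists p, (sg *: q); split.
  - by rewrite !dotpE !mxE /= w1 w2; split; field.
  - rewrite !dotpE !mxE /=.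
    transitivity ((Num.sqrt 3 ^+ 2)^-1 * (3 / 2) : R); first by field.
    by rewrite s3; field.
  - rewrite !dotpE !mxE /=.
    by transitivity (sg * sg / 2); [field | rewrite sg2 mul1r].
  - by apply: cV3_eq; rewrite /vw /= r0 eqxx /= /v2w0 !mxE /= /sg;
      case: ifP => _; rewrite !mxE; simpc; rewrite ?conj_complexE;
      congr (_ +i* _); field.
  - by apply: cV3_eq; rewrite /vw /= r0 eqxx /= /v2w0 !mxE /= /sg;
      case: ifP => _; rewrite !mxE; simpc; rewrite ?conj_complexE;
      congr (_ +i* _); field.
have nr0 := enorm_neq0 _ r0.
have s20 : Num.sqrt 2 != 0 :> R by rewrite sqrtr_eq0 -ltNge.
have s2 : Num.sqrt 2 ^+ 2 = 2 :> R by rewrite sqr_sqrtr.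
(* Before division by nu_w, both p and q have squared length |r_w|^2 / |w|^2, which is nu_w^2 /
   2. *)
have nu2 : (nuw w)^-1 ^+ 2 * (dotp (rw w) (rw w) / enorm w ^+ 2) = 2^-1.
  rewrite -enorm_sqr /nuw; transitivity ((Num.sqrt 2 ^+ 2)^-1 : R).
    by field; rewrite n0 nr0 s20.
  by rewrite s2.
pose p : 'cV[R]_3 := (sw w / enorm w ^+ 2) *: w - vec3 1 1 1.
pose q : 'cV[R]_3 := (enorm w)^-1 *: rw w.
have nE : enorm w / enorm w ^+ 2 = (enorm w)^-1 by field.
have one_to_complex : vec3 1 1 1 = to_complex (vec3 1 1 1) :> 'cV[R[i]]_3.
  by apply: cV3_eq; rewrite !mxE.
(* Here [k] stands for 1/nu_w and [m] for mu_d/|w|^2, so one identity serves both signs of mu_d. *)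
have vdE (k m : R) :
  k%:C *: ((sw w / enorm w ^+ 2)%:C *: to_complex w - vec3 1 1 1
           - ('i * m%:C) *: to_complex (rw w))
  = to_complex (k *: p) + 'i *: to_complex ((k * - m) *: rw w).
  have kmE : (k * - m)%:C = - (k%:C * m%:C) :> R[i].
    by rewrite rmorphM rmorphN mulrN.
  rewrite one_to_complex !(to_complexZ, to_complexB) kmE.
  by apply/matrixP => i j; rewrite !mxE; ring.
exists ((nuw w)^-1 *: p), ((nuw w)^-1 *: q).
have wp : dotp w p = 0.
  transitivity (sw w * ((w 0 0 * w 0 0 + w 1 0 * w 1 0 + w 2 0 * w 2 0)
                        / enorm w ^+ 2 - 1)).
    by rewrite dotpE !mxE /= /sw; ring.
  by rewrite -nn; field.
have pp : dotp p p = dotp (rw w) (rw w) / enorm w ^+ 2.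
  (* Only one factor p is expanded, so that w.p = 0 applies; Lagrange's identity then finishes. *)
  transitivity (sw w / enorm w ^+ 2 * dotp w p + 3 - sw w ^+ 2 / enorm w ^+ 2).
    by rewrite !dotpE !mxE /= /sw; ring.
  by rewrite wp dotp_rw; field.
have dotpZ a u v : dotp (a *: u) (a *: v) = a ^+ 2 * dotp u v :> R.
  by rewrite !dotpE !mxE; ring.
split.
- split.
  + transitivity ((nuw w)^-1 * dotp w p); last by rewrite wp mulr0.
    by rewrite !dotpE !mxE; ring.
  + by rewrite !dotpE !mxE /=; ring.
  + by rewrite !dotpE !mxE /= /sw; ring.
- by rewrite dotpZ pp nu2.
- by rewrite dotpZ /q dotpZ (exprVn (enorm w) 2) [_^-1 * dotp _ _]mulrC nu2.
- rewrite /vw /= r0 [muw _ _]/= mulNr nE vdE; congr (_ + _ *: to_complex _).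
  by rewrite opprK -scalerA.
- rewrite /vw /= r0 [muw _ _]/= nE vdE -scalerN; congr (_ + _ *: _).
  by rewrite mulrN scaleNr to_complexN -scalerA.
Qed.

Lemma bdot_to_complex (p q : 'cV[R]_3) :
  bdot (to_complex p) (to_complex q) = (dotp p q)%:C.
Proof. by rewrite bdotE dotpE !mxE !(rmorphD, rmorphM). Qed.

Lemma conjv_to_complex (p : 'cV[R]_3) : conjv (to_complex p) = to_complex p.
Proof. by apply/matrixP => i j; rewrite !mxE; exact: conjc_real. Qed.

Lemma vw_frame : isotropic_frame (vw w 0) (vw w 1) (vw w 2).
Proof.
have [p [q [[wp wq pq] pp qq -> ->]]] := vw_split.
have n0 := enorm_neq0 w w_neq0.
have ww : dotp ((enorm w)^-1 *: w) ((enorm w)^-1 *: w) = 1.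
  transitivity ((enorm w)^-1 ^+ 2 * dotp w w).
    by rewrite !dotpE !mxE; ring.
  by rewrite -enorm_sqr; field.
have wZ v : dotp w v = 0 -> dotp ((enorm w)^-1 *: w) v = 0.
  move=> wv; transitivity ((enorm w)^-1 * dotp w v); last by rewrite wv mulr0.
  by rewrite !dotpE !mxE; ring.
have half : (2^-1 : R)%:C = 2^-1 by rewrite fmorphV rmorph_nat.
apply: (@bdot_isotropic _ (to_complex ((enorm w)^-1 *: w)));
  rewrite ?bdot_to_complex ?ww ?pq ?pp ?qq ?(wZ p wp) ?(wZ q wq) //.
by rewrite -expr2 sqr_i.
Qed.

Lemma conjv_vw :
  [/\ conjv (vw w 0) = vw w 0, conjv (vw w 1) = vw w 2 &
      conjv (vw w 2) = vw w 1].
Proof.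
have [p [q [_ _ _ v1 v2]]] := vw_split.
have conj12 : conjv (vw w 1) = vw w 2.
  rewrite v1 v2; apply/matrixP => i j; rewrite !mxE.
  by simpc; rewrite conj_complexE.
split; [exact: conjv_to_complex | exact: conj12 |].
by rewrite -conj12; apply/matrixP => i j; rewrite !mxE; exact: conjCK.
Qed.

(** * Products of the field with itself and its conjugate *)

Variables (eps mu : R) (alpha : 'cV[R[i]]_3).

(** The values 0, -|w|, |w| of mu_d give the time phases 1, e^{iy}, e^{-iy}. *)
Lemma Ffield_frame x t :
  let y := t * enorm w / Num.sqrt (mu * eps) in
  Ffield eps mu alpha w x t =
    cexp ('i * (dotp x w)%:C) *:
      (alpha 0 0 *: vw w 0 + (cexp ('i * y%:C) * alpha 1 0) *: vw w 1
       + (cexp ('i * (- y)%:C) * alpha 2 0) *: vw w 2).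
Proof.
move=> y; rewrite /Ffield sum3E.
have phase m : - 'i * t%:C * m%:C / (Num.sqrt (mu * eps))%:C
   = 'i * (- (t * m / Num.sqrt (mu * eps)))%:C :> R[i].
  by rewrite rmorphN !rmorphM fmorphV; ring.
rewrite !phase /muw /= mulr0 mul0r mulrN mulNr oppr0 opprK cexp_imag0 -/y.
move: (vw w 0) (vw w 1) (vw w 2) (cexp _) (cexp _) (cexp _) => v0 v1 v2 u c c'.
by apply/matrixP => i j; rewrite !mxE; ring.
Qed.

(** The opposite phases meet in v_2.v_3 and cancel; the spatial factor survives squared, so this
    product yields stationarity but not constancy in x. *)
Lemma bdot_Ffield x t :
  bdot (Ffield eps mu alpha w x t) (Ffield eps mu alpha w x t) =
  cexp ('i * (dotp x w)%:C) ^+ 2 * (alpha 0 0 ^+ 2 + 2 * alpha 1 0 * alpha 2 0).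
Proof.
rewrite Ffield_frame (bdot_frame _ _ _ _ _ _ _ _ vw_frame).
set y := t * _ / _; have := cexp_mulN _ y.
move: (cexp ('i * y%:C)) (cexp ('i * (- y)%:C)) (cexp ('i * (dotp x w)%:C)).
move=> c c' u cc.
transitivity (u ^+ 2 * (alpha 0 0 ^+ 2 + c * c' * (2 * alpha 1 0 * alpha 2 0))).
  by ring.
by rewrite cc mul1r.
Qed.

(** The last two terms are swapped because conjugation exchanges v_2 and v_3; the result is again in
    the order of the frame. *)
Lemma conjv_comb (z a b c : R[i]) (e u v : 'cV[R[i]]_3) :
  conjv (z *: (a *: e + b *: u + c *: v))
  = Num.conj z *: (Num.conj a *: conjv e + Num.conj c *: conjv v
                   + Num.conj b *: conjv u).
Proof.
by apply/matrixP => i j; rewrite !mxE rmorphM !rmorphD !rmorphM addrAC.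
Qed.

(** Each coefficient now meets its own conjugate, so every phase, spatial or temporal, cancels
    against its inverse. *)
Lemma bdot_conj_Ffield x t :
  bdot (Ffield eps mu alpha w x t) (conjv (Ffield eps mu alpha w x t)) =
  \sum_(d < 3) alpha d 0 * Num.conj (alpha d 0).
Proof.
rewrite sum3E Ffield_frame; set y := t * _ / _.
(* The vectors are generalized because unification would otherwise try to
   convert [vw w 1] to [vw w 2] by unfolding. *)
have [c0 c1 c2] := conjv_vw; have frame := vw_frame.
move: (vw w 0) (vw w 1) (vw w 2) c0 c1 c2 frame => v0 v1 v2 c0 c1 c2 frame.
rewrite conjv_comb c0 c1 c2 (bdot_frame _ _ _ _ _ _ _ _ frame).
have conjM (p q : R[i]) : Num.conj (p * q) = Num.conj p * Num.conj q.
  exact: rmorphM.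
have := cexp_mulN _ (dotp x w); have := cexp_mulN _ y.
have := cexp_conj _ (dotp x w); have := cexp_conj _ y.
have := cexp_conj _ (- y); rewrite opprK.
move: (cexp ('i * y%:C)) (cexp ('i * (- y)%:C))
  (cexp ('i * (dotp x w)%:C)) (cexp ('i * (- dotp x w)%:C)).
move=> c c' u u' cJ' cJ uJ cc uu; rewrite !conjM cJ cJ' uJ.
transitivity (u * u' * (alpha 0 0 * Num.conj (alpha 0 0)
  + c * c' * (alpha 1 0 * Num.conj (alpha 1 0))
  + c * c' * (alpha 2 0 * Num.conj (alpha 2 0)))).
  by ring.
by rewrite uu cc !mul1r.
Qed.

End Eigenframe.

(** * E and H as real and imaginary parts of F, and the conclusion *)

Lemma Efield_Re {R : realType} (eps mu : R) alpha w x t :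
  Efield eps mu alpha w x t
  = map_mx (@complex.Re R) (Ffield eps mu alpha w x t).
Proof.
rewrite /Efield /EfieldC; move: (Ffield _ _ _ _ _ _) => f.
apply/matrixP => i j; rewrite !mxE.
by case: (f i j) => a b; rewrite conj_complexE; simpc => /=; field.
Qed.

Lemma Hfield_Im {R : realType} (eps mu : R) alpha w x t :
  Hfield eps mu alpha w x t
  = map_mx (@complex.Im R) (Ffield eps mu alpha w x t).
Proof.
rewrite /Hfield /HfieldC; move: (Ffield _ _ _ _ _ _) => f.
apply/matrixP => i j; rewrite !mxE.
by case: (f i j) => a b; rewrite conj_complexE; simpc => /=; field.
Qed.

Theorem proposition2p5 (R : realType) (eps mu : R) (heps : 0 < eps) (hmu : 0 < mu)
    (w : 'cV[R]_3) (hw : w != 0) (a alpha : 'cV[R[i]]_3)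
    (halpha : alpha = (Vw w)^t* *m a) :
  let E := Efield eps mu alpha w in
  let H := Hfield eps mu alpha w in
  (exists c : R, forall (x : 'cV[R]_3) (t : R),
     enorm (E x t) ^+ 2 + enorm (H x t) ^+ 2 = c) /\
  (forall (x : 'cV[R]_3) (t t' : R),
     [/\ enorm (E x t) = enorm (E x t'),
         enorm (H x t) = enorm (H x t') &
         dotp (E x t) (H x t) = dotp (E x t') (H x t')]).
Proof.
rewrite /=.
have EE x t := Efield_Re eps mu alpha w x t.
have HH x t := Hfield_Im eps mu alpha w x t.
have dotF x t := bdot_Ffield _ _ hw eps mu alpha x t.
have dotFconj x t := bdot_conj_Ffield _ _ hw eps mu alpha x t.
move: (Efield _ _ _ _) (Hfield _ _ _ _) (Ffield _ _ _ _) EE HH dotF dotFconj.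
move=> E H F EE HH dotF dotFconj.
have sumEH x t : enorm (E x t) ^+ 2 + enorm (H x t) ^+ 2
    = complex.Re (\sum_(d < 3) alpha d 0 * Num.conj (alpha d 0)).
  by rewrite !enorm_sqr -(dotFconj x t) bdot_conj -EE -HH.
split=> [|x t t']; first by eexists; exact: sumEH.
have : bdot (F x t) (F x t) = bdot (F x t') (F x t') by rewrite !dotF.
(* Real and imaginary parts of F.F: |E|^2 - |H|^2 and 2 E.H agree at both times. With the constant
   sum |E|^2 + |H|^2, this fixes each square. *)
rewrite !bdot_self -!EE -!HH -!enorm_sqr => -[eqB eqEH].
have eqD := sumEH x t; rewrite -(sumEH x t') in eqD.
have normE : enorm (E x t) ^+ 2 = enorm (E x t') ^+ 2 by lra.
have normH : enorm (H x t) ^+ 2 = enorm (H x t') ^+ 2 by lra.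
split.
- by apply/eqP; rewrite -(@eqrXn2 _ 2) ?sqrtr_ge0 // normE.
- by apply/eqP; rewrite -(@eqrXn2 _ 2) ?sqrtr_ge0 // normH.
- by lra.
Qed.
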